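(* Let $p$ be a prime with $p\equiv 9 \pmod{10}$ and let $n$ be a nonnegative integer. Then for every $i\in\{1,2,\ldots,p-1\}$, $$\overline{A}_5(p(pn+i))\equiv 0 \pmod{5}.$$
   Context: An overpartition of $n$ is a partition of $n$ in which the first occurrence of each distinct part may be overlined. For a positive integer $\ell$, $\overline{A}_\ell(n)$ denotes the number of overpartitions of $n$ into parts not divisible by $\ell$, with $\overline{A}_\ell(0)=1$; equivalently $$\sum_{n\ge 0}\overline{A}_\ell(n)q^n=\frac{(q^\ell;q^\ell)_\infty^2(q^2;q^2)_\infty}{(q;q)_\infty^2(q^{2\ell};q^{2\ell})_\infty},\qquad (a;q)_\infty=\prod_{k\ge 0}(1-aq^k).$$ *)

(* Defs.v *)
From mathcomp Require Import all_boot.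

Set Implicit Arguments.
Unset Strict Implicit.
Unset Printing Implicit Defensive.

(* A partition of [n] is given by its multiplicities: [i : 'I_n] stands for the
   part [i.+1], which occurs [m i] times. *)
Definition is_partition (n : nat) (m : {ffun 'I_n -> 'I_n.+1}) : bool :=
  \sum_(i < n) m i * i.+1 == n.

(* Only the first occurrence of a part can be overlined, so the overlining is
   the choice of a set [ov] of parts among those that occur. *)
Definition is_overpartition (n : nat) (m : {ffun 'I_n -> 'I_n.+1})
    (ov : {set 'I_n}) : bool :=
  is_partition m && [forall i in ov, 0 < m i].

(* The number of overpartitions of [n] into parts not divisible by [l]. *)
Definition Abar (l n : nat) : nat :=
  #|[set w : {ffun 'I_n -> 'I_n.+1} * {set 'I_n} |
      is_overpartition w.1 w.2 &&
      [forall i, (0 < w.1 i) ==> ~~ (l %| i.+1)]]|.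

(* Main.v *)
From HB Require Import structures.
From mathcomp Require Import all_boot all_order all_algebra boolp zify ring.
Require Import Defs.

(** Let theta = 1 + 2 sum_(s >= 1) q^(s^2), x = theta(q) and y = theta(-q). By
    Gauss, y = prod_k (1 - q^k) / (1 + q^k), so the generating function of
    overpartitions into parts not divisible by 5, that is
    y(q^5) / y(q), is y^4 modulo 5. Up to sign, its n-th coefficient is the
    number r4(n) of representations of n as a sum of four squares.

    The rotation (u, v) |-> (u + v, u - v) gives the arithmetic-geometric mean
    relations x^2 + y^2 = 2 x(q^2)^2 and x y = y(q^2)^2. They imply that x^4 - y^4
    and 4 q d/dq log (x / y) satisfy the same functional equation relating f(q^2)
    to f(q). This equation determines f from its first two coefficients, so the
    two series are equal. Since y is an explicit product, this yields
    r4(n) = 8 sigma(n) for odd n, while the relations give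
    r4(2m) = (2 - (-1)^m) r4(m). If p does not divide m, then
    sigma(p m) = (p + 1) sigma(m), which vanishes modulo 5 when p = 9 mod 10. *)

Set Implicit Arguments.
Unset Strict Implicit.
Unset Printing Implicit Defensive.

Import GRing.Theory Num.Theory.

(** * Formal power series *)

Record fps (R : Type) := Fps { fcoef :> nat -> R }.

Section FormalPowerSeries.

Local Open Scope ring_scope.

Lemma fpsP (R : Type) (f g : fps R) : f =1 g -> f = g.
Proof. by case: f => f; case: g => g /= /funext->. Qed.

HB.instance Definition _ (R : Type) := gen_eqMixin (fps R).
HB.instance Definition _ (R : Type) := gen_choiceMixin (fps R).

Variable R : comNzRingType.
Implicit Types f g h : fps R.

Definition fps_zero : fps R := Fps (fun=> 0).
Definition fps_opp f : fps R := Fps (fun n => - f n).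
Definition fps_add f g : fps R := Fps (fun n => f n + g n).

Fact fps_addA : associative fps_add.
Proof. by move=> f g h; apply: fpsP => n /=; rewrite addrA. Qed.
Fact fps_addC : commutative fps_add.
Proof. by move=> f g; apply: fpsP => n /=; rewrite addrC. Qed.
Fact fps_add0 : left_id fps_zero fps_add.
Proof. by move=> f; apply: fpsP => n /=; rewrite add0r. Qed.
Fact fps_addN : left_inverse fps_zero fps_opp fps_add.
Proof. by move=> f; apply: fpsP => n /=; rewrite addNr. Qed.

HB.instance Definition _ :=
  GRing.isZmodule.Build (fps R) fps_addA fps_addC fps_add0 fps_addN.

Definition fps_one : fps R := Fps (fun n => (n == 0)%N%:R).
Definition fps_mul f g : fps R :=
  Fps (fun n => \sum_(i < n.+1) f i * g (n - i)%N).

(** Up to degree [N], a product of series depends only on these truncations, so associativity and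
    commutativity are inherited from [{poly R}]. *)
Definition trunc_fps N f : {poly R} := \poly_(i < N.+1) f i.

Lemma coef_trunc_fps N f n : (n <= N)%N -> (trunc_fps N f)`_n = f n.
Proof. by move=> le_nN; rewrite coef_poly ltnS le_nN. Qed.

Lemma coef_fps_mul N f g n : (n <= N)%N ->
  fps_mul f g n = (trunc_fps N f * trunc_fps N g)`_n.
Proof.
move=> le_nN; rewrite coefM; apply: eq_bigr => i _ /=.
by rewrite !coef_trunc_fps //; have := ltn_ord i; lia.
Qed.

Fact fps_mulA : associative fps_mul.
Proof.
move=> f g h; apply: fpsP => n.
have E (a b : fps R) (p q : {poly R}) : (forall k, (k <= n)%N -> a k = p`_k) ->
    (forall k, (k <= n)%N -> b k = q`_k) -> fps_mul a b n = (p * q)`_n.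
  move=> ap bq; rewrite coefM; apply: eq_bigr => i _ /=.
  by rewrite ap ?bq //; have := ltn_ord i; lia.
rewrite (E _ _ (trunc_fps n f) (trunc_fps n g * trunc_fps n h)).
- rewrite (E _ _ (trunc_fps n f * trunc_fps n g) (trunc_fps n h)) ?mulrA //.
    by move=> k; apply: coef_fps_mul.
  by move=> k le_kn; rewrite coef_trunc_fps.
- by move=> k le_kn; rewrite coef_trunc_fps.
by move=> k; apply: coef_fps_mul.
Qed.

Fact fps_mulC : commutative fps_mul.
Proof.
by move=> f g; apply: fpsP => n; rewrite !(@coef_fps_mul n) // mulrC.
Qed.

Fact fps_mul1 : left_id fps_one fps_mul.
Proof.
move=> f; apply: fpsP => n /=; rewrite big_ord_recl /= mul1r subn0.
by rewrite big1 ?addr0 // => i _; rewrite mul0r.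
Qed.

Fact fps_mulDl : left_distributive fps_mul fps_add.
Proof.
move=> f g h; apply: fpsP => n /=; rewrite -big_split /=.
by apply: eq_bigr => i _; rewrite mulrDl.
Qed.

Fact fps_one_neq0 : fps_one != 0.
Proof. by apply/eqP => /(congr1 (fun f : fps R => f 0%N))/eqP; rewrite /= oner_eq0. Qed.

HB.instance Definition _ := GRing.Zmodule_isComNzRing.Build (fps R)
  fps_mulA fps_mulC fps_mul1 fps_mulDl fps_one_neq0.

Lemma fcoef0 n : (0 : fps R) n = 0. Proof. by []. Qed.
Lemma fcoef1 n : (1 : fps R) n = (n == 0)%N%:R. Proof. by []. Qed.
Lemma fcoefD f g n : (f + g) n = f n + g n. Proof. by []. Qed.
Lemma fcoefN f n : (- f) n = - f n. Proof. by []. Qed.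
Lemma fcoefB f g n : (f - g) n = f n - g n. Proof. by []. Qed.
Lemma fcoefM f g n : (f * g) n = \sum_(i < n.+1) f i * g (n - i)%N.
Proof. by []. Qed.

Lemma fcoefM_trunc N f g n : (n <= N)%N ->
  (f * g) n = (trunc_fps N f * trunc_fps N g)`_n.
Proof. exact: coef_fps_mul. Qed.

Lemma fcoefMn f k n : (f *+ k) n = f n *+ k.
Proof. by elim: k => // k IH; rewrite !mulrS fcoefD IH. Qed.

Lemma fcoef_sum I (r : seq I) (P : pred I) (F : I -> fps R) n :
  (\sum_(i <- r | P i) F i) n = \sum_(i <- r | P i) F i n.
Proof. by apply: (big_morph (fun f : fps R => f n)). Qed.

Lemma fcoef_natr k n : (k%:R : fps R) n = (if n == 0%N then k%:R else 0).
Proof. by rewrite fcoefMn fcoef1; case: eqP => // _; rewrite mul0rn. Qed.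

Lemma fcoefMnatl k f n : (k%:R * f) n = k%:R * f n.
Proof. by rewrite mulr_natl fcoefMn mulr_natl. Qed.

Lemma fcoefM0 f g : (f * g) 0%N = f 0%N * g 0%N.
Proof. by rewrite fcoefM big_ord_recl big_ord0 addr0. Qed.

Lemma fcoefM1 f g : (f * g) 1%N = f 0%N * g 1%N + f 1%N * g 0%N.
Proof. by rewrite fcoefM !big_ord_recl big_ord0 addr0. Qed.

(** Congruence modulo q^(N+1), by which infinite products are compared with finite ones. *)
Definition eq_upto N f g := forall n, (n <= N)%N -> f n = g n.

Lemma eq_upto_refl N f : eq_upto N f f. Proof. by []. Qed.

Lemma eq_upto_sym N f g : eq_upto N f g -> eq_upto N g f.
Proof. by move=> fg n /fg. Qed.

Lemma eq_upto_trans N f g h : eq_upto N f g -> eq_upto N g h -> eq_upto N f h.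
Proof. by move=> fg gh n le_nN; rewrite fg // gh. Qed.

Lemma eq_uptoM N f f' g g' :
  eq_upto N f f' -> eq_upto N g g' -> eq_upto N (f * g) (f' * g').
Proof.
move=> ff' gg' n le_nN; rewrite !fcoefM; apply: eq_bigr => i _.
by have := ltn_ord i => lt_in; rewrite ff' ?gg' //; lia.
Qed.

Lemma eq_uptoX N f g k : eq_upto N f g -> eq_upto N (f ^+ k) (g ^+ k).
Proof.
move=> fg; elim: k => [|k IH]; first exact: eq_upto_refl.
by rewrite !exprS; apply: eq_uptoM.
Qed.

Lemma eq_upto_prod N I (r : seq I) (P : pred I) (F G : I -> fps R) :
  (forall i, P i -> eq_upto N (F i) (G i)) ->
  eq_upto N (\prod_(i <- r | P i) F i) (\prod_(i <- r | P i) G i).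
Proof.
move=> FG; apply: (big_ind2 (eq_upto N)) => //.
by move=> *; apply: eq_uptoM.
Qed.

Definition fpsX k : fps R := Fps (fun n => (n == k)%N%:R).

Lemma fcoefXM k f n : (fpsX k * f) n = if (k <= n)%N then f (n - k)%N else 0.
Proof.
rewrite fcoefM; case: leqP => [le_kn|lt_nk].
  rewrite (bigD1 (Ordinal (le_kn : k < n.+1)%N)) //= eqxx mul1r.
  rewrite big1 ?addr0 // => i; rewrite -val_eqE /= => /negbTE->.
  by rewrite mul0r.
rewrite big1 // => i _ /=; rewrite (_ : (_ == _) = false) ?mul0r //.
by apply/eqP; have := ltn_ord i; lia.
Qed.

Lemma fpsX0 : fpsX 0 = 1. Proof. by []. Qed.

Lemma fpsXD a b : fpsX (a + b)%N = fpsX a * fpsX b.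
Proof.
apply: fpsP => n; rewrite fcoefXM /=.
case: leqP => h; first by congr (nat_of_bool _)%:R; lia.
by rewrite (_ : _ == _ = false) //; lia.
Qed.

Lemma fpsXM a b : fpsX (a * b)%N = fpsX a ^+ b.
Proof.
elim: b => [|b IH]; first by rewrite muln0 expr0 fpsX0.
by rewrite mulnS fpsXD IH exprS.
Qed.

Lemma eq_uptoXM N k f : (N < k)%N -> eq_upto N (fpsX k * f) 0.
Proof. by move=> lt_Nk n le_nN; rewrite fcoefXM ifN // -ltnNge; lia. Qed.

Lemma fps_unit_cancel f g : f 0%N = 1 -> f * g = 0 -> g = 0.
Proof.
move=> f0 fg0; apply: fpsP => n; elim/ltn_ind: n => n IH.
have := congr1 (fun h : fps R => h n) fg0.
rewrite fcoefM big_ord_recl f0 mul1r subn0 big1 ?addr0 // => i _.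
by rewrite IH ?mulr0 //= /bump; have := ltn_ord i; lia.
Qed.

(* f(-q) *)
Definition fps_sign f : fps R := Fps (fun n => (-1) ^+ n * f n).

Lemma fcoef_sign f n : fps_sign f n = (-1) ^+ n * f n. Proof. by []. Qed.

Lemma fps_signM f g : fps_sign (f * g) = fps_sign f * fps_sign g.
Proof.
apply: fpsP => n; rewrite fcoefM /= big_distrr /=.
apply: eq_bigr => i _; have -> : (-1) ^+ n = (-1) ^+ i * (-1) ^+ (n - i) :> R.
  by rewrite -exprD subnKC // -ltnS.
by ring.
Qed.

Lemma fps_signK f : fps_sign (fps_sign f) = f.
Proof. by apply: fpsP => n /=; rewrite mulrA -expr2 sqrr_sign mul1r. Qed.

(* f(q^2) *)
Definition fps_dbl f : fps R :=
  Fps (fun n => if (2 %| n)%N then f (n %/ 2)%N else 0).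

Lemma fcoef_dbl f n :
  fps_dbl f n = if (2 %| n)%N then f (n %/ 2)%N else 0.
Proof. by []. Qed.

Lemma fps_dblM f g : fps_dbl (f * g) = fps_dbl f * fps_dbl g.
Proof.
apply: fpsP => n; rewrite [RHS](@fcoefM_trunc n) //.
(* On truncations, substituting q^2 is composition with ['X^2], which is multiplicative on
   polynomials. *)
have E h k : (k <= n)%N -> fps_dbl h k = (trunc_fps n h \Po 'X^2)`_k.
  move=> le_kn; rewrite coef_comp_poly_Xn //=.
  by rewrite coef_trunc_fps //; lia.
have -> : (trunc_fps n (fps_dbl f) * trunc_fps n (fps_dbl g))`_n =
          ((trunc_fps n f \Po 'X^2) * (trunc_fps n g \Po 'X^2))`_n.
  rewrite !coefM; apply: eq_bigr => i _; have lt_in := ltn_ord i.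
  by rewrite !coef_trunc_fps ?E //; lia.
rewrite -comp_polyM coef_comp_poly_Xn // -fcoefM_trunc //.
by lia.
Qed.

Lemma fps_dblB f g : fps_dbl (f - g) = fps_dbl f - fps_dbl g.
Proof. by apply: fpsP => n /=; case: ifP; rewrite /= ?subr0. Qed.

Lemma fps_dbl_natMl k f : fps_dbl (k%:R * f) = k%:R * fps_dbl f.
Proof.
apply: fpsP => n; rewrite fcoefMnatl !fcoef_dbl fcoefMnatl.
by case: ifP; rewrite ?mulr0.
Qed.

(* q df/dq *)
Definition fps_der f : fps R := Fps (fun n => n%:R * f n).

Lemma fcoef_der f n : fps_der f n = n%:R * f n. Proof. by []. Qed.

Lemma fps_derD f g : fps_der (f + g) = fps_der f + fps_der g.
Proof. by apply: fpsP => n /=; rewrite mulrDr. Qed.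

Lemma fps_derN f : fps_der (- f) = - fps_der f.
Proof. by apply: fpsP => n /=; rewrite mulrN. Qed.

Lemma fps_der1 : fps_der 1 = 0.
Proof. by apply: fpsP => -[|n] /=; rewrite ?mul0r ?mulr0. Qed.

Lemma fps_derM f g : fps_der (f * g) = fps_der f * g + f * fps_der g.
Proof.
apply: fpsP => n; rewrite fcoefD !fcoefM /= big_distrr -big_split /=.
apply: eq_bigr => i _; have -> : n%:R = i%:R + (n - i)%:R :> R.
  by rewrite -natrD subnKC // -ltnS.
by ring.
Qed.

Lemma fps_derX k : fps_der (fpsX k) = k%:R * fpsX k.
Proof.
by apply: fpsP => n; rewrite fcoefMnatl /=; case: eqP => [->//|]; rewrite !mulr0.
Qed.

Lemma fps_der_sign f : fps_der (fps_sign f) = fps_sign (fps_der f).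
Proof. by apply: fpsP => n /=; ring. Qed.

Lemma fps_der_dbl f : fps_der (fps_dbl f) = 2%:R * fps_dbl (fps_der f).
Proof.
apply: fpsP => n; rewrite fcoefMnatl /=; case: ifP => [d2n|]; rewrite ?mulr0 //.
by rewrite mulrA -natrM; congr (_%:R * _); lia.
Qed.

End FormalPowerSeries.

Arguments fpsX {R} k.

(** * The product formula for theta *)

Lemma divn_subr k n : 0 < k <= n -> n %/ k = ((n - k) %/ k).+1.
Proof.
case/andP=> k_gt0 le_kn.
by rewrite -{1}(subnK le_kn) divnDr // divnn k_gt0 addn1.
Qed.

Section ThetaProduct.

Local Open Scope ring_scope.

Variable R : comNzRingType.
Implicit Types f g : fps R.

(** For k > 0, the series 1 / (1 - c q^k). *)
Definition geometric (c : R) k : fps R :=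
  Fps (fun n => if (k %| n)%N then c ^+ (n %/ k) else 0).

Lemma fcoef_geometric c k n : (0 < k)%N ->
  geometric c k n = (n == 0)%N%:R + c * (fpsX k * geometric c k) n.
Proof.
move=> k_gt0; rewrite fcoefXM /=; case: leqP => [le_kn|lt_nk].
  have -> : (k %| n - k)%N = (k %| n)%N by rewrite dvdn_subl.
  have -> : (n == 0)%N = false by lia.
  rewrite add0r; case: ifP => d_kn; last by rewrite mulr0.
  by rewrite -exprS -divn_subr ?k_gt0.
rewrite mulr0 addr0; case: n lt_nk => [|n] lt_nk; first by rewrite dvdn0 div0n.
by rewrite gtnNdvd.
Qed.

Lemma geometric1 k : (0 < k)%N -> (1 - fpsX k) * geometric 1 k = 1.
Proof.
move=> k_gt0; apply: fpsP => n; rewrite mulrBl mul1r fcoefB.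
by rewrite fcoef_geometric // mul1r addrK.
Qed.

Lemma geometricN1 k : (0 < k)%N -> (1 + fpsX k) * geometric (-1) k = 1.
Proof.
move=> k_gt0; apply: fpsP => n; rewrite mulrDl mul1r fcoefD.
by rewrite fcoef_geometric // mulN1r subrK.
Qed.

(** This is (1 - q^k) / (1 + q^k); its inverse [over_factor k] generates the occurrences of the part
    k in an overpartition. *)
Definition theta_factor k : fps R := (1 - fpsX k) * geometric (-1) k.
Definition over_factor k : fps R := (1 + fpsX k) * geometric 1 k.

Lemma theta_over_factor k : (0 < k)%N -> theta_factor k * over_factor k = 1.
Proof.
move=> k_gt0; transitivity
  (((1 - fpsX k) * geometric 1 k) * ((1 + fpsX k) * geometric (-1) k)).
  by rewrite /theta_factor /over_factor; ring.
by rewrite geometric1 // geometricN1 // mulr1.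
Qed.

Definition theta_prod n : fps R := \prod_(1 <= k < n.+1) theta_factor k.
Definition over_prod n : fps R := \prod_(1 <= k < n.+1) over_factor k.

Lemma theta_over_prod n : theta_prod n * over_prod n = 1.
Proof.
rewrite -big_split /= big_nat big1 // => k /andP[k_gt0 _].
exact: theta_over_factor.
Qed.

Lemma theta_prodS n : theta_prod n.+1 = theta_prod n * theta_factor n.+1.
Proof. by rewrite /theta_prod big_nat_recr. Qed.

Lemma over_prodS n : over_prod n.+1 = over_prod n * over_factor n.+1.
Proof. by rewrite /over_prod big_nat_recr. Qed.

(* Shanks' finite form of Gauss's identity: the correction to the partial
   product telescopes in the number of factors. *)
Definition shanks_sum m N : fps R :=
  \sum_(1 <= s < m.+1) (-1) ^+ s * over_prod s * geometric (-1) s *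
    fpsX (s * N)%N.

Lemma shanks_sumS m N : shanks_sum m.+1 N = shanks_sum m N +
  (-1) ^+ m.+1 * over_prod m.+1 * geometric (-1) m.+1 * fpsX (m.+1 * N)%N.
Proof. by rewrite /shanks_sum big_nat_recr. Qed.

(** Multiplying by the factor of index [N] lowers the second argument of the correction from N + 1
    to N, up to one boundary term. *)
Lemma shanks_telescope N m : (0 < N)%N ->
  theta_factor N * (1 + 2%:R * shanks_sum m N.+1) =
  1 + 2%:R * shanks_sum m N +
  (-1) ^+ m.+1 * 2%:R * geometric (-1) N * over_prod m * fpsX (m.+1 * N)%N.
Proof.
move=> N_gt0; rewrite /theta_factor; have gN := geometricN1 N_gt0.
elim: m => [|m IH].
  rewrite /shanks_sum /over_prod !big_geq // mul1n.
  set g := geometric _ _ in gN *; set X := fpsX N in gN *.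
  transitivity ((1 + X) * g - 2%:R * X * g); first by ring.
  by rewrite gN; ring.
have h1 := @geometric1 m.+1 isT; have g1 := @geometricN1 m.+1 isT.
rewrite !shanks_sumS over_prodS /over_factor.
rewrite mulnS (mulSn m.+1 N) (fpsXD _ m.+1) (fpsXD _ N) [(-1) ^+ m.+2]exprS.
move: IH h1 g1 gN; rewrite exprS.
set s := (-1) ^+ m; set a := fpsX m.+1; set b := fpsX N.
set Y := fpsX (_ * _)%N; set A := shanks_sum _ _; set B := shanks_sum _ _.
set gN := geometric (-1) N; set h := geometric 1 _; set g := geometric (-1) _.
set O := over_prod m.
move=> IH h1 g1 gN1.
(* Writing 1 as [(1 + b) * gN] on the left and as [(1 - a) * h] on the right turns both sides into h
   gN (a - b - a b - 1). *)
have E : h * ((1 - b) * gN * a - 1) = - gN * ((1 + a) * h * b + 1).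
  transitivity (h * ((1 - b) * gN * a - (1 + b) * gN)); first by rewrite gN1.
  transitivity (- gN * ((1 + a) * h * b + (1 - a) * h)); last by rewrite h1.
  by ring.
transitivity ((1 - b) * gN * (1 + 2%:R * A) -
  2%:R * s * O * Y * ((1 + a) * g) * (h * ((1 - b) * gN * a))); first by ring.
transitivity (1 + 2%:R * B - 2%:R * s * O * Y * h * ((1 + a) * g) +
  2%:R * s * gN * O * (1 + a) * h * b * Y); last by ring.
have -> : h * ((1 - b) * gN * a) = - gN * ((1 + a) * h * b + 1) + h.
  by rewrite -E; ring.
by rewrite g1 IH; ring.
Qed.

Definition theta_sum N : fps R :=
  1 + 2%:R * \sum_(1 <= s < N.+1) fpsX (s ^ 2)%N.

Lemma theta_sumS N :
  theta_sum N.+1 = theta_sum N + 2%:R * fpsX (N.+1 ^ 2)%N.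
Proof. by rewrite /theta_sum big_nat_recr //= mulrDr addrA. Qed.

Definition theta_sumN N : fps R :=
  1 + 2%:R * \sum_(1 <= s < N.+1) (-1) ^+ s * fpsX (s ^ 2)%N.

Lemma shanks_identity n :
  theta_prod n * (1 + 2%:R * shanks_sum n n.+1) = theta_sumN n.
Proof.
elim: n => [|n IH].
  by rewrite /theta_sumN /shanks_sum /theta_prod !big_geq // mul1r.
rewrite shanks_sumS theta_prodS /theta_sumN big_nat_recr //=.
have := @shanks_telescope n.+1 n isT.
have := theta_over_prod n.+1; rewrite theta_prodS.
have := theta_over_prod n.
have := @geometricN1 n.+1 isT.
move: IH; rewrite /theta_sumN.
rewrite (mulnS n.+1 n.+1) -[(n.+1 ^ 2)%N]mulnn (fpsXD _ n.+1).
set S := \sum_(_ <= _ < _) _; set P := theta_prod n.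
set t := theta_factor _; set O := over_prod n; set O' := over_prod n.+1.
set g := geometric _ _; set X := fpsX n.+1; set Y := fpsX (_ * _)%N.
set A := shanks_sum n _; set B := shanks_sum n _; set s := (-1) ^+ _.
move=> IH g1 PO PO' T.
transitivity (P * (t * (1 + 2%:R * B)) + 2%:R * s * (P * t * O') * g * X * Y).
  by ring.
(* The boundary term of the telescoping and the new last term of the correction add up to 2
   (-1)^(n+1) q^((n+1)^2), because g + g q^(n+1) = 1. *)
rewrite T PO'; transitivity
  (P * (1 + 2%:R * A) + 2%:R * s * Y * (P * O * g + g * X)); first by ring.
rewrite IH PO; have -> : 1 * g + g * X = 1 by rewrite -[RHS]g1; ring.
by ring.
Qed.

(** Every term of the correction in [shanks_identity] is divisible by q^(n+1). *)
Lemma theta_prod_sum n : eq_upto n (theta_prod n) (theta_sumN n).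
Proof.
rewrite -shanks_identity -[X in eq_upto _ X _]mulr1.
apply: eq_uptoM => // k le_kn; rewrite fcoefD fcoefMnatl fcoef_sum big_nat.
rewrite big1 ?mulr0 ?addr0 // => s /andP[s_gt0 _]; rewrite mulrC.
by rewrite (@eq_uptoXM _ n) //; nia.
Qed.

(** The diagonal of the partial sums suffices: a term with s > n has exponent s^2 > n. *)
Definition theta : fps R := Fps (fun n => theta_sum n n).
Definition thetaN : fps R := fps_sign theta.

Lemma theta_sum_eq N : eq_upto N theta (theta_sum N).
Proof.
move=> n /subnK <-; elim: (N - n)%N => // k ->; rewrite addSn.
rewrite theta_sumS fcoefD fcoefMnatl -[fpsX _]mulr1 (@eq_uptoXM _ n) //.
  by rewrite mulr0 addr0.
by nia.
Qed.

Lemma fcoefMsign k f n : ((-1) ^+ k * f) n = (-1) ^+ k * f n.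
Proof.
elim: k => [|k IH]; first by rewrite !mul1r.
by rewrite !exprS -!mulrA !mulN1r fcoefN IH.
Qed.

Lemma theta_sumN_sign N : theta_sumN N = fps_sign (theta_sum N).
Proof.
apply: fpsP => n; rewrite fcoef_sign !fcoefD !fcoefMnatl !fcoef_sum mulrDr.
congr (_ + _); first by case: n => [|n] /=; rewrite ?mul1r ?mulr0.
rewrite mulrCA; congr (_ * _); rewrite big_distrr; apply: eq_bigr => s _.
rewrite fcoefMsign /=; case: eqP => [->|]; rewrite ?mulr0 //.
by rewrite -[in RHS]signr_odd oddX /= signr_odd.
Qed.

Lemma thetaN_prod n : eq_upto n thetaN (theta_prod n).
Proof.
move=> k le_kn; rewrite theta_prod_sum // theta_sumN_sign !fcoef_sign.
by rewrite (theta_sum_eq le_kn).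
Qed.

(** The logarithmic derivative q d/dq log of [theta_factor k]. *)
Definition logder_factor k : fps R :=
  - (k%:R * (fpsX k * (geometric 1 k + geometric (-1) k))).

Lemma fcoef_logder_factor k n : logder_factor k n = - (k%:R *
  if (k <= n)%N then geometric 1 k (n - k)%N + geometric (-1) k (n - k)%N else 0).
Proof. by rewrite fcoefN fcoefMnatl fcoefXM. Qed.

Lemma theta_factor_der k : (0 < k)%N ->
  fps_der (theta_factor k) = theta_factor k * logder_factor k.
Proof.
move=> k_gt0; have h1 := geometric1 k_gt0; have g1 := geometricN1 k_gt0.
have := congr1 (@fps_der R) g1.
rewrite !fps_derM !fps_derD fps_derN fps_der1 fps_derX /logder_factor.
rewrite /theta_factor; move: h1 g1.
set h := geometric 1 k; set g := geometric (-1) k; set X := fpsX k.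
set d := fps_der g; move=> h1 g1 E.
have -> : d = - (k%:R * X * g * g).
  have -> : d = g * ((0 + k%:R * X) * g + (1 + X) * d) - k%:R * X * g * g.
    by rewrite -[LHS]mul1r -[in LHS]g1; ring.
  by rewrite E mulr0 add0r.
transitivity (- (k%:R * X * g * (((1 - X) * h) + (1 - X) * g))); last by ring.
by rewrite h1; ring.
Qed.

Definition logder_sum n : fps R := \sum_(1 <= k < n.+1) logder_factor k.

Lemma logder_sumS n : logder_sum n.+1 = logder_sum n + logder_factor n.+1.
Proof. by rewrite /logder_sum big_nat_recr. Qed.

Lemma theta_prod_der n :
  fps_der (theta_prod n) = theta_prod n * logder_sum n.
Proof.
elim: n => [|n IH].
  by rewrite /logder_sum /theta_prod !big_geq // fps_der1 mulr0.
rewrite theta_prodS fps_derM IH theta_factor_der // logder_sumS.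
by ring.
Qed.

Definition logder : fps R := Fps (fun n => logder_sum n n).

Lemma logder_sum_eq N : eq_upto N logder (logder_sum N).
Proof.
move=> n /subnK <-; elim: (N - n)%N => // k ->; rewrite addSn.
rewrite logder_sumS fcoefD [X in _ + X]fcoefN fcoefMnatl.
by rewrite (@eq_uptoXM _ n) ?fcoef0 ?mulr0 ?subr0 //; lia.
Qed.

Lemma thetaN_der : fps_der thetaN = thetaN * logder.
Proof.
apply: fpsP => n; rewrite fcoef_der (@thetaN_prod n) //.
rewrite -fcoef_der theta_prod_der.
by apply: eq_uptoM (leqnn n); apply: eq_upto_sym;
  [apply: thetaN_prod | apply: logder_sum_eq].
Qed.

(** If k divides the odd number n, then n / k - 1 is even, so both geometric series in
    [logder_factor k] contribute 1 and k has total weight -2k. *)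
Lemma logder_odd n : odd n ->
  logder n = - (2%:R * (\sum_(d <- divisors n) d)%N%:R).
Proof.
move=> n_odd; have n_gt0 : (0 < n)%N by rewrite odd_gt0.
have -> : (\sum_(d <- divisors n) d =
           \sum_(1 <= d < n.+1) if d %| n then d else 0)%N.
  rewrite -big_mkcond -[RHS]big_filter; apply: perm_big; apply: uniq_perm.
  - exact: divisors_uniq.
  - by rewrite filter_uniq // iota_uniq.
  move=> d; rewrite -dvdn_divisors // mem_filter mem_index_iota.
  case d_n: (d %| n)%N => //=.
  by rewrite ltnS (dvdn_gt0 n_gt0 d_n) dvdn_leq.
have -> : logder n = \sum_(1 <= k < n.+1) logder_factor k n by apply: fcoef_sum.
rewrite natr_sum big_distrr -sumrN; apply: eq_big_nat => k /andP[k_gt0 lt_kn].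
rewrite fcoef_logder_factor -ltnS lt_kn; congr (- _).
rewrite /geometric /= expr1n dvdn_subl //; case: ifP => d_kn; last first.
  by rewrite addr0 !mulr0.
have q_even : odd ((n - k) %/ k) = false.
  have := n_odd; rewrite -{1}(divnK d_kn) oddM => /andP[+ _].
  by rewrite divn_subr ?k_gt0 // oddS => /negbTE.
by rewrite -signr_odd q_even mulrC.
Qed.

End ThetaProduct.

(** * Sums of two squares *)

Section TwoSquares.

Local Open Scope ring_scope.

Lemma Posz_inj : injective Posz. Proof. by move=> m n []. Qed.

Definition int_box N : seq int :=
  [seq i%:Z | i <- index_iota 0 N.+1] ++ [seq - i%:Z | i <- index_iota 1 N.+1].

Lemma mem_int_box N a : (a \in int_box N) = (`|a| <= N)%N.
Proof.
rewrite mem_cat; apply/orP/idP.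
  by case=> /mapP[i]; rewrite mem_index_iota => iN ->; lia.
move=> aN; case: (lerP 0 a) => [a_ge0|a_lt0]; [left|right]; apply/mapP.
  by exists `|a|%N; rewrite ?mem_index_iota; lia.
by exists `|a|%N; rewrite ?mem_index_iota; lia.
Qed.

Lemma int_box_uniq N : uniq (int_box N).
Proof.
rewrite cat_uniq !map_inj_uniq ?iota_uniq ?andbT //; first last.
- by move=> i j; lia.
- by move=> i j; lia.
apply/hasPn => a /mapP[i]; rewrite mem_index_iota => iN ->.
by apply/mapP => -[j _]; lia.
Qed.

Definition pair_box N := [seq (a, b) | a <- int_box N, b <- int_box N].

Definition sqnorm (z : int * int) : nat := (`|z.1| ^ 2 + `|z.2| ^ 2)%N.

Lemma mem_pair_box N z : (z \in pair_box N) = (`|z.1| <= N)%N && (`|z.2| <= N)%N.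
Proof.
rewrite -!mem_int_box; apply/allpairsP/andP => [[[a b] [aN bN ->]]//|].
by case=> z1 z2; exists z; split=> //; case: z {z1 z2}.
Qed.

Lemma pair_box_uniq N : uniq (pair_box N).
Proof. by rewrite allpairs_uniq ?int_box_uniq // => -[a b] [c d] _ _ [-> ->]. Qed.

Lemma sqnormZ z : (sqnorm z)%:Z = z.1 ^+ 2 + z.2 ^+ 2.
Proof. by rewrite /sqnorm PoszD -!abszX !abszE !ger0_norm ?sqr_ge0. Qed.

(* The rotation (u, v) |-> (u + v, u - v) doubles the norm. *)
Lemma count_sqnorm_double N m : (2 * m <= N)%N ->
  count (fun z => 2 * m == sqnorm z)%N (pair_box N) =
  count (fun z => m == sqnorm z)%N (pair_box N).
Proof.
move=> le_mN; rewrite -!size_filter.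
pose rot (z : int * int) := (z.1 + z.2, z.1 - z.2).
rewrite -[RHS](size_map rot); apply: perm_size; apply: uniq_perm.
- by rewrite filter_uniq ?pair_box_uniq.
- rewrite map_inj_uniq ?filter_uniq ?pair_box_uniq //.
  by move=> [a b] [c d] [] *; congr (_, _); lia.
(* Since a <= a^2, the box contains every integer pair of norm at most [N]. *)
have bound z k : (k <= N)%N -> k == sqnorm z -> z \in pair_box N.
  have sq a : (a <= a ^ 2)%N by rewrite -mulnn; nia.
  move=> le_kN /eqP def_k; rewrite mem_pair_box /=.
  move: (sq `|z.1|%N) (sq `|z.2|%N) def_k; rewrite /sqnorm.
  by move: (`|z.1| ^ 2)%N (`|z.2| ^ 2)%N => a b; lia.
move=> z; rewrite mem_filter; apply/andP/mapP.
- case=> /eqP z2m _; have z2mZ := congr1 Posz z2m.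
  case: z z2m z2mZ => a b z2m z2mZ; rewrite sqnormZ /= in z2mZ.
  (* As a^2 + b^2 is even, so is a + b; the preimage of (a, b) is ((a + b) / 2, (a - b) / 2). *)
  have [c ac] : exists c, a + b = 2%:Z * c.
    by exists ((a + b) %/ 2)%Z; nia.
  have mc : m == sqnorm (c, a - c).
    by apply/eqP; apply: Posz_inj; rewrite sqnormZ /=; nia.
  exists (c, a - c); last by rewrite /rot /=; congr (_, _); lia.
  by rewrite mem_filter mc (bound _ m) //; lia.
case=> -[u v]; rewrite mem_filter => /andP[/eqP muv _] ->.
have muvZ := congr1 Posz muv; rewrite sqnormZ /= in muvZ.
have rot2m : (2 * m)%N == sqnorm (rot (u, v)).
  apply/eqP; apply: Posz_inj.
  by rewrite sqnormZ PoszM muvZ /=; ring.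
by split=> //; apply: bound rot2m.
Qed.

Variable R : comNzRingType.

(** The factor 2 in [theta_sum] accounts for the two integers s and -s. *)
Lemma theta_sum_box N :
  theta_sum R N = \sum_(a <- int_box N) fpsX (`|a| ^ 2)%N.
Proof.
rewrite big_cat !big_map big_ltn //= fpsX0 -addrA; congr (_ + _).
rewrite mulr_natl mulr2n; congr (_ + _); apply: eq_bigr => i _.
by rewrite abszN.
Qed.

Lemma fcoef_theta2 N n : (n <= N)%N ->
  (theta R * theta R) n = (count (fun z => n == sqnorm z) (pair_box N))%:R.
Proof.
move=> le_nN; rewrite (eq_uptoM (@theta_sum_eq R N) (@theta_sum_eq R N)) //.
transitivity ((\sum_(z <- pair_box N) fpsX (sqnorm z) : fps R) n).
  rewrite big_allpairs theta_sum_box big_distrlr; congr (fcoef _ n).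
  by apply: eq_bigr => a _; apply: eq_bigr => b _; rewrite /sqnorm fpsXD.
rewrite fcoef_sum -sum1_count natr_sum [RHS]big_mkcond.
by apply: eq_bigr => z _ /=; case: eqP.
Qed.

Lemma fcoef_theta2_double m :
  (theta R * theta R) (2 * m)%N = (theta R * theta R) m.
Proof.
rewrite (@fcoef_theta2 (2 * m)) // (@fcoef_theta2 (2 * m) m); last by lia.
by rewrite count_sqnorm_double.
Qed.

End TwoSquares.

(** * Sums of four squares *)

Lemma sqr_mod4 k : exists c, k ^ 2 = 4 * c + odd k.
Proof.
exists (k./2 * (k./2 + odd k)); rewrite -{1}(odd_double_half k) -mulnn.
by case: (odd k); nia.
Qed.

Section FourSquares.

Local Open Scope ring_scope.

Variable R : idomainType.
Hypothesis two_neq0 : 2%:R != 0 :> R.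

Let x := theta R.
Let y := thetaN R.
Let ey := logder R.
Let ex := fps_sign ey.

Lemma mulr2_eq0 (a : R) : 2%:R * a = 0 -> a = 0.
Proof. by move/eqP; rewrite mulf_eq0 (negbTE two_neq0) => /eqP. Qed.

Lemma sign_thetaN : fps_sign y = x.
Proof. exact: fps_signK. Qed.

Lemma theta_der : fps_der x = x * ex.
Proof. by rewrite -sign_thetaN fps_der_sign thetaN_der fps_signM. Qed.

Lemma fcoef_theta n : x n = theta_sum R n n. Proof. by []. Qed.

Lemma theta0 : x 0%N = 1.
Proof. by rewrite fcoef_theta /theta_sum big_geq // mulr0 addr0. Qed.

Lemma theta1 : x 1%N = 2%:R.
Proof.
by rewrite fcoef_theta /theta_sum big_nat1 fcoefD fcoefMnatl /= mulr1 add0r.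
Qed.

Lemma theta_nonsquare n : (forall s, n <> s ^ 2)%N -> x n = 0.
Proof.
move=> nsq; rewrite fcoef_theta /theta_sum fcoefD fcoefMnatl fcoef_sum.
rewrite big1 => [|s _]; last by have := nsq s => /eqP/negbTE /= ->.
by rewrite mulr0 addr0; have := nsq 0%N; case: n nsq.
Qed.

Lemma thetaN2 n : (y * y) n = (-1) ^+ n * (x * x) n.
Proof. by rewrite -fps_signM. Qed.

(** Odd coefficients cancel on the left; the even ones follow from r2(2m) = r2(m), where r2 counts
    representations by two squares. *)
Lemma theta2_thetaN2 : x ^+ 2 + y ^+ 2 = 2%:R * fps_dbl x ^+ 2.
Proof.
apply: fpsP => n; rewrite !expr2 fcoefD fcoefMnatl -fps_dblM thetaN2 fcoef_dbl.
case: ifP => [d2n|nd2n]; last first.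
  by rewrite -signr_odd (_ : odd n) ?mulN1r ?subrr ?mulr0 //; lia.
rewrite -signr_odd (_ : odd n = false); last by lia.
by rewrite -{1 2}(divnK d2n) mulnC fcoef_theta2_double; ring.
Qed.

(** The left side is invariant under q |-> -q, so its odd coefficients vanish. For n even, s^2 + t^2
    = n forces s and t to have the same parity, which modulo 4 is seen to be that of n / 2; hence
    the sign (-1)^(t^2) is (-1)^(n / 2). *)
Lemma theta_thetaN : x * y = fps_dbl y ^+ 2.
Proof.
apply: fpsP => n; rewrite expr2 -fps_dblM fcoef_dbl thetaN2.
case: ifP => [d2n|nd2n]; last first.
  apply: mulr2_eq0; have n_odd : odd n by lia.
  have : (fps_sign (x * y)) n = (x * y) n.
    by rewrite fps_signM sign_thetaN mulrC.
  rewrite fcoef_sign -signr_odd n_odd mulN1r => /eqP.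
  by rewrite eq_sym -addr_eq0 => /eqP; rewrite mulr_natl mulr2n.
(* As r2(n / 2) = r2(n), both sides become sums over the same pairs (i, n - i). *)
rewrite -fcoef_theta2_double mulnC divnK // !fcoefM big_distrr.
apply: eq_bigr => i _; move: (nat_of_ord i) (ltn_ord i) => {}i lt_in.
rewrite -[X in _ = X]/((-1) ^+ (n %/ 2) * (x i * x (n - i)%N)) [in LHS]fcoef_sign.
rewrite -/x.
have [/existsP[s /eqP si]|/existsPn nsq] := boolP [exists s : 'I_i.+1, i == s ^ 2]%N;
  last first.
  rewrite [x i]theta_nonsquare ?mul0r ?mulr0 // => s is2.
  have lt_si : (s < i.+1)%N by rewrite is2 -mulnn; nia.
  by have := nsq (Ordinal lt_si); rewrite /= is2 eqxx.
have [/existsP[t /eqP ti]|/existsPn nsq] :=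
    boolP [exists t : 'I_(n - i).+1, (n - i)%N == t ^ 2]%N; last first.
  rewrite [x (n - i)%N]theta_nonsquare ?mulr0 // => t nit2.
  have lt_ti : (t < (n - i).+1)%N by rewrite nit2 -mulnn; nia.
  by have := nsq (Ordinal lt_ti); rewrite /= nit2 eqxx.
rewrite mulrCA; congr (_ * _); rewrite -signr_odd -[RHS]signr_odd.
congr (_ ^+ nat_of_bool _).
have [c sc] := sqr_mod4 s; have [d td] := sqr_mod4 t.
by rewrite sc in si; rewrite td in ti; lia.
Qed.

(** This is the logarithmic derivative of x y = y(q^2)^2; the factor x y can be cancelled as its
    constant term is 1. *)
Lemma logder_dbl : 4%:R * fps_dbl ey = ex + ey.
Proof.
apply/eqP; rewrite eq_sym -subr_eq0; apply/eqP.
apply: (@fps_unit_cancel _ (x * y)); first by rewrite fcoefM0 fcoef_sign theta0 !mul1r.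
have := congr1 (@fps_der R) theta_thetaN.
rewrite expr2 !fps_derM theta_der thetaN_der fps_der_dbl thetaN_der fps_dblM.
rewrite -/y -/ey => E.
have -> : x * y * (ex + ey - 4%:R * fps_dbl ey) =
  x * ex * y + x * (y * ey) - 4%:R * (x * y) * fps_dbl ey by ring.
by rewrite E theta_thetaN; ring.
Qed.

(** Differentiate x^2 + y^2 = 2 x(q^2)^2, then eliminate x(q^2)^2 by the same relation. *)
Lemma logder_dbl_sign :
  4%:R * (x ^+ 2 + y ^+ 2) * fps_dbl ex = 2%:R * (x ^+ 2 * ex + y ^+ 2 * ey).
Proof.
have := congr1 (@fps_der R) theta2_thetaN2.
have d2 : fps_der 2%:R = 0 :> fps R.
  by rewrite -[2%:R]/(1 + 1) fps_derD fps_der1 addr0.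
rewrite !expr2 fps_derD !fps_derM d2 fps_der_dbl theta_der thetaN_der fps_dblM.
rewrite -/y -/ey -!expr2 => E.
transitivity (x * ex * x + x * (x * ex) + (y * ey * y + y * (y * ey))).
  rewrite E theta2_thetaN2; ring.
by ring.
Qed.

Let L := ex - ey.

(* The functional equation of the arithmetic-geometric mean, satisfied both
   by the logarithmic derivative of x / y and by x^4 - y^4. *)
Definition agm_equation (f : fps R) :=
  8%:R * (x ^+ 2 + y ^+ 2) * fps_dbl f = 2%:R * (x ^+ 2 - y ^+ 2) * f.

Lemma agm_logder : agm_equation L.
Proof.
rewrite /agm_equation /L fps_dblB.
transitivity (2%:R * (4%:R * (x ^+ 2 + y ^+ 2) * fps_dbl ex) -
  2%:R * (x ^+ 2 + y ^+ 2) * (4%:R * fps_dbl ey)); first by ring.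
by rewrite logder_dbl_sign logder_dbl; ring.
Qed.

(** The mean relations give x(q^2)^4 - y(q^2)^4 = ((x^2 + y^2) / 2)^2 - (x y)^2 = ((x^2 - y^2) /
    2)^2. *)
Lemma agm_theta4 : agm_equation (x ^+ 4 - y ^+ 4).
Proof.
rewrite /agm_equation -[x ^+ 4]/(x ^+ (2 * 2)) -[y ^+ 4]/(y ^+ (2 * 2)) !exprM.
rewrite fps_dblB !expr2 !fps_dblM -!expr2.
transitivity (2%:R * (x ^+ 2 + y ^+ 2) *
  ((2%:R * fps_dbl x ^+ 2) ^+ 2 - 4%:R * (fps_dbl y ^+ 2) ^+ 2)); first by ring.
by rewrite -theta_thetaN -theta2_thetaN2; ring.
Qed.

Lemma fcoefM_shift (a f : fps R) n : a 0%N = 0 ->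
  (forall m, (m < n)%N -> f m = 0) -> (a * f) n.+1 = a 1%N * f n.
Proof.
move=> a0 f0; rewrite fcoefM big_ord_recl a0 mul0r add0r big_ord_recl big1.
  by rewrite addr0 subn1.
by move=> i _; have lt_in := ltn_ord i; rewrite f0 ?mulr0 //= /bump; lia.
Qed.

Lemma agm_coef01 (a := 2%:R * (x ^+ 2 - y ^+ 2)) :
  a 0%N = 0 /\ a 1%N = 16%:R.
Proof.
rewrite /a !fcoefMnatl !fcoefB !expr2 !thetaN2 fcoefM0 fcoefM1 theta0 theta1.
by split; ring.
Qed.

(* The coefficient of q^(n+1) expresses the n-th coefficient of f
   through those of index at most (n + 1) / 2. *)
Lemma agm_unique f : agm_equation f -> f 0%N = 0 -> f 1%N = 0 -> f = 0.
Proof.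
move=> fE f0 f1; apply: fpsP => n; elim/ltn_ind: n => -[|[|n]] IH //.
have [a0 a1] := agm_coef01.
have := congr1 (fun g : fps R => g n.+3) fE; rewrite [in RHS]fcoefM_shift //.
rewrite a1 fcoefM big1 => [E|i _]; last first.
  rewrite fcoef_dbl; case: ifP => _; rewrite ?mulr0 //.
  by rewrite IH ?mulr0 //; lia.
(* The leading coefficient 16 is 2^4. *)
by do 4 apply: mulr2_eq0; rewrite [RHS]E; ring.
Qed.

Lemma logder0 : ey 0%N = 0.
Proof. by rewrite -[LHS]/(logder_sum R 0 0%N) /logder_sum big_geq. Qed.

Lemma thetaN4 n : (y ^+ 4) n = (-1) ^+ n * (x ^+ 4) n.
Proof.
rewrite -fcoef_sign; congr (fcoef _ n).
by rewrite -[4%N]/(2 * 2)%N !exprM !expr2 !fps_signM.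
Qed.

Lemma theta4_coef1 : (x ^+ 4) 1%N = 8%:R.
Proof.
rewrite -[4%N]/(2 * 2)%N exprM !expr2 !fcoefM1 !fcoefM0 theta0 theta1.
by ring.
Qed.

Lemma theta4_sub : x ^+ 4 - y ^+ 4 = 4%:R * L.
Proof.
apply/esym/eqP; rewrite -subr_eq0; apply/eqP; apply: agm_unique.
- rewrite /agm_equation fps_dblB fps_dbl_natMl.
  transitivity (4%:R * (8%:R * (x ^+ 2 + y ^+ 2) * fps_dbl L) -
     8%:R * (x ^+ 2 + y ^+ 2) * fps_dbl (x ^+ 4 - y ^+ 4)); first by ring.
  by rewrite agm_logder agm_theta4; ring.
- by rewrite !fcoefB thetaN4 fcoefMnatl fcoefB fcoef_sign logder0; ring.
(* Both coefficients of q are 16: 8 + 8 from x^4 - y^4, and 4 (2 + 2) from 4 L. *)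
rewrite !fcoefB thetaN4 theta4_coef1 fcoefMnatl fcoefB fcoef_sign.
by rewrite (@logder_odd R 1) // (_ : divisors 1 = [:: 1%N]) // big_seq1; ring.
Qed.

(** At odd n, the two sides of [theta4_sub] have coefficients 2 r4(n) and -8 times that of [ey]. *)
Lemma theta4_odd n : odd n ->
  (x ^+ 4) n = 8%:R * (\sum_(d <- divisors n) d)%N%:R.
Proof.
move=> n_odd; apply/eqP; rewrite -subr_eq0; apply/eqP; apply: mulr2_eq0.
have := congr1 (fun f : fps R => f n) theta4_sub.
rewrite fcoefB thetaN4 fcoefMnatl fcoefB fcoef_sign logder_odd //.
rewrite -signr_odd n_odd => E.
transitivity ((x ^+ 4) n - (-1) ^+ 1 * (x ^+ 4) n -
  16%:R * (\sum_(d <- divisors n) d)%N%:R); first by ring.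
by rewrite E; ring.
Qed.

Lemma theta4_double m :
  (x ^+ 4) (2 * m)%N = (2%:R - (-1) ^+ m) * (x ^+ 4) m.
Proof.
apply/eqP; rewrite -subr_eq0; apply/eqP; apply: mulr2_eq0.
(* This expands (x^2 + y^2)^2 - 2 (x y)^2; the even coefficients on the left are twice those of
   x^4. *)
have E : x ^+ 4 + y ^+ 4 = 4%:R * fps_dbl (x ^+ 4) - 2%:R * fps_dbl (y ^+ 4).
  rewrite -[4%N]/(2 * 2)%N !exprM !expr2 !fps_dblM -!expr2.
  rewrite -theta_thetaN.
  transitivity ((2%:R * fps_dbl x ^+ 2) ^+ 2 - 2%:R * (x * y) ^+ 2);
    last by ring.
  by rewrite -theta2_thetaN2; ring.
have := congr1 (fun f : fps R => f (2 * m)%N) E.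
rewrite fcoefD fcoefB !fcoefMnatl !fcoef_dbl dvdn_mulr // mulKn // !thetaN4.
rewrite -[(-1) ^+ (2 * m)]signr_odd oddM andFb => {}E.
rewrite mulrBr; apply/eqP; rewrite subr_eq0; apply/eqP.
transitivity ((x ^+ 4) (2 * m)%N + (-1) ^+ 0 * (x ^+ 4) (2 * m)%N).
  by ring.
by rewrite E; ring.
Qed.

End FourSquares.

(** * The generating function of overpartitions *)

(** The number of ways to overline a part k that occurs j times, with 0 when a forbidden part
    occurs. *)
Definition overline_weight (l k j : nat) : nat :=
  if j == 0 then 1 else if l %| k then 0 else 2.

(** The overlinings of a partition without multiples of [l] are the subsets of its set of parts, so
    each part gives a factor 2; any other partition has a zero factor. *)
Lemma Abar_weight l n :
  Abar l n = \sum_(m : {ffun 'I_n -> 'I_n.+1} | is_partition m)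
               \prod_(i < n) overline_weight l i.+1 (m i).
Proof.
rewrite /Abar -sum1dep_card -(pair_big_dep predT
  (fun m ov => is_overpartition m ov && [forall i, (0 < m i) ==> ~~ (l %| i.+1)])
  (fun _ _ => 1)) /= [RHS]big_mkcond; apply: eq_bigr => m _.
rewrite /is_overpartition; case: (is_partition m) => /=; last first.
  by rewrite big_pred0_eq.
have [good|] := boolP [forall i, (0 < m i) ==> ~~ (l %| i.+1)]; last first.
  rewrite negb_forall => /existsP[i]; rewrite negb_imply negbK => /andP[mi di].
  rewrite big_pred0 => [|ov]; last by rewrite andbF.
  by rewrite (bigD1 i) //= /overline_weight di gtn_eqF.
pose supp := [set i | 0 < m i].
transitivity #|powerset supp|.
  rewrite -sum1_card; apply: eq_bigl => ov; rewrite andbT inE.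
  by apply/forall_inP/subsetP => ov_supp i /ov_supp; rewrite inE.
rewrite card_powerset -prod_nat_const [LHS]big_mkcond; apply: eq_bigr => i _.
rewrite inE /overline_weight lt0n; case: eqP => //= /eqP mi.
by have /forallP/(_ i) := good; rewrite lt0n mi /= => /negbTE->.
Qed.

Section GeneratingFunction.

Local Open Scope ring_scope.

Variable R : comNzRingType.

Lemma fcoef_over_factor k n : (0 < k)%N ->
  over_factor R k n = if (k %| n)%N then if n == 0%N then 1 else 2%:R else 0.
Proof.
move=> k_gt0; rewrite /over_factor mulrDl mul1r fcoefD fcoefXM.
rewrite /geometric [LHS]/= !expr1n; case: n => [|n]; first by rewrite dvdn0 leqNgt k_gt0 addr0.
case: leqP => [le_kn|lt_nk]; last by rewrite gtnNdvd // addr0.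
by rewrite dvdn_subl //; case: ifP; rewrite ?addr0.
Qed.

(** Multiplicities up to [N] suffice in degree [N], and a finite sum allows the product over the
    parts to be expanded by distributivity. *)
Lemma over_factor_sum N k : (0 < k)%N ->
  eq_upto N (over_factor R k)
    (\sum_(j < N.+1) (if j == 0%N :> nat then 1 else 2%:R) * fpsX (j * k)%N).
Proof.
move=> k_gt0 n le_nN; rewrite fcoef_over_factor // fcoef_sum.
have E (j : 'I_N.+1) :
  ((if j == 0%N :> nat then 1 else 2%:R) * fpsX (j * k)%N : fps R) n =
  if n == (j * k)%N then (if j == 0%N :> nat then 1 else 2%:R) else 0.
  by case: ifP => _; rewrite ?mul1r ?fcoefMnatl /=; case: eqP; rewrite ?mulr1 ?mulr0.
under eq_bigr do rewrite E; rewrite -big_mkcond /=.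
case: ifP => [d_kn|nd_kn]; last first.
  by rewrite big1 // => j /eqP nj; rewrite nj dvdn_mull in nd_kn.
have lt_q : (n %/ k < N.+1)%N by rewrite ltnS (leq_trans (leq_div _ _)).
rewrite (big_pred1 (Ordinal lt_q)) => [|j] /=.
  by rewrite -{1}(divnK d_kn) muln_eq0 (gtn_eqF k_gt0) orbF.
by rewrite -val_eqE /= -{1}(divnK d_kn) eqn_pmul2r // eq_sym.
Qed.

Lemma Abar_prod l n :
  (Abar l n)%:R = (\prod_(1 <= k < n.+1 | ~~ (l %| k)%N) over_factor R k) n.
Proof.
rewrite big_mkcond big_add1 /= big_mkord.
pose F (i : 'I_n) : fps R :=
  \sum_(j < n.+1) (overline_weight l i.+1 j)%:R * fpsX (j * i.+1)%N.
have FE (i : 'I_n) : eq_upto n (if ~~ (l %| i.+1)%N then over_factor R i.+1 else 1) (F i).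
  case: ifP => [nd|/negbFE d].
    apply: eq_upto_trans (over_factor_sum _) _ => // k _.
    congr (fcoef _ k); apply: eq_bigr => j _.
    by rewrite /overline_weight (negbTE nd); case: eqP.
  rewrite /F big_ord_recl big1 ?addr0 => [|j _]; first by rewrite mul1r mul0n.
  by rewrite /overline_weight d /= mul0r.
(* Expanding the product chooses a multiplicity for every part, that is, a function [m]. *)
rewrite (@eq_upto_prod _ n _ _ _ _ F) // bigA_distr_bigA fcoef_sum.
rewrite Abar_weight natr_sum big_mkcond; apply: eq_bigr => m _.
have -> : \prod_(i < n)
    ((overline_weight l i.+1 (m i))%:R * fpsX (m i * i.+1)%N) =
    (\prod_(i < n) overline_weight l i.+1 (m i))%N%:R *
    fpsX (\sum_(i < n) m i * i.+1)%N :> fps R.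
  rewrite big_split natr_prod; congr (_ * _); apply/esym.
  by apply: (big_morph (@fpsX R)) => [a b|]; rewrite ?fpsXD.
by rewrite fcoefMnatl /is_partition eq_sym /=; case: eqP; rewrite ?mulr1 ?mulr0.
Qed.

End GeneratingFunction.

(** * Reduction modulo 5 *)

Section ModFive.

Local Open Scope ring_scope.

Variable R : idomainType.
Hypothesis five0 : 5%:R = 0 :> R.

Lemma fps_five : 5%:R = 0 :> fps R.
Proof. by apply: fpsP => n; rewrite fcoef_natr five0; case: ifP. Qed.

Lemma fps_expD5 (f g : fps R) : (f + g) ^+ 5 = f ^+ 5 + g ^+ 5.
Proof.
transitivity (f ^+ 5 + g ^+ 5 + 5%:R * (f ^+ 4 * g + 2%:R * f ^+ 3 * g ^+ 2 +
  2%:R * f ^+ 2 * g ^+ 3 + f * g ^+ 4)); first by ring.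
by rewrite fps_five mul0r addr0.
Qed.

(** Modulo 5 the fifth power is additive, so it replaces q^k by q^(5k) in both 1 + q^k and 1 -
    q^k. *)
Lemma over_factor_exp5 k : (0 < k)%N ->
  over_factor R k ^+ 5 = over_factor R (k * 5)%N.
Proof.
move=> k_gt0; rewrite /over_factor exprMn fps_expD5 expr1n -fpsXM; congr (_ * _).
have h1 := @geometric1 R _ k_gt0.
have h5 : (1 - fpsX (k * 5)%N) * geometric 1 (k * 5)%N = 1 :> fps R.
  by apply: geometric1; lia.
rewrite -[LHS]mulr1 -h5 mulrA; have -> : 1 - fpsX (k * 5)%N = (1 - fpsX k) ^+ 5 :> fps R.
  by rewrite fps_expD5 expr1n fpsXM; ring.
by rewrite [geometric 1 k ^+ 5 * _]mulrC -exprMn h1 expr1n mul1r.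
Qed.

Lemma prod_multiples5 (G : nat -> fps R) n :
  \prod_(1 <= k < (n * 5).+1 | (5 %| k)%N) G k = \prod_(1 <= k < n.+1) G (k * 5)%N.
Proof.
have recr a : \prod_(1 <= k < a.+2 | (5 %| k)%N) G k =
    \prod_(1 <= k < a.+1 | (5 %| k)%N) G k * (if (5 %| a.+1)%N then G a.+1 else 1).
  by rewrite big_mkcond big_nat_recr //= -big_mkcond.
elim: n => [|n IH]; first by rewrite !big_geq.
rewrite [RHS]big_nat_recr //= -IH mulSn -[(5 + _)%N]/(n * 5).+4.+1 !recr.
rewrite ifF ?mulr1; last by lia.
rewrite ifF ?mulr1; last by lia.
rewrite ifF ?mulr1; last by lia.
rewrite ifF ?mulr1; last by lia.
by rewrite ifT //; lia.
Qed.

Lemma over_factor_upto n k : (n < k)%N -> eq_upto n (over_factor R k) 1.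
Proof.
move=> lt_nk m le_mn; rewrite fcoef_over_factor; last by lia.
case: m le_mn => [|m] le_mn; first by rewrite dvdn0.
by rewrite gtnNdvd //; lia.
Qed.

(** Let O = 1 / P be the full product and O = B C, where C collects the multiples of 5. Up to degree
    n, C agrees with O^5, hence B with O^(-4) = P^4. *)
Lemma Abar5_theta n : (Abar 5 n)%:R = (thetaN R ^+ 4) n.
Proof.
rewrite (eq_uptoX 4 (@thetaN_prod R n)) // Abar_prod.
set P := theta_prod R n; set B := \prod_(_ <= _ < _ | _) _.
pose C := \prod_(1 <= k < n.+1 | (5 %| k)%N) over_factor R k.
pose O := over_prod R n.
have PO : P * O = 1 by apply: theta_over_prod.
have OBC : O = B * C.
  by rewrite /O /over_prod (bigID (fun k => 5 %| k)%N) /= mulrC.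
have CO : eq_upto n C (O ^+ 5).
  have -> : O ^+ 5 = \prod_(1 <= k < (n * 5).+1 | (5 %| k)%N) over_factor R k.
    rewrite prod_multiples5 /O /over_prod -prodrXl; apply: eq_big_nat => k kn.
    by rewrite over_factor_exp5 //; lia.
  (* The multiples of 5 beyond n only add factors congruent to 1 modulo q^(n+1). *)
  rewrite (@big_cat_nat _ _ _ n.+1 1 (n * 5).+1) //; last by lia.
  rewrite -[X in eq_upto _ X]mulr1; apply: eq_uptoM; first exact: eq_upto_refl.
  rewrite big_nat_cond; apply: (big_ind (eq_upto n 1)); first exact: eq_upto_refl.
    by move=> f g f1 g1; rewrite -[X in eq_upto _ X]mulr1; apply: eq_uptoM.
  by move=> k kn; apply/eq_upto_sym/over_factor_upto; lia.
have -> : B = B * O ^+ 5 * P ^+ 5.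
  by rewrite -mulrA -exprMn [O * P]mulrC PO expr1n mulr1.
have -> : P ^+ 4 = B * C * P ^+ 5.
  by rewrite -OBC [P ^+ 5]exprS mulrA [O * P]mulrC PO mul1r.
apply: (@eq_uptoM _ n) => //; apply: eq_uptoM; first exact: eq_upto_refl.
exact: eq_upto_sym.
Qed.

(** The divisors of p m are the d and the p d with d dividing m, without overlap because p does not
    divide m. *)
Lemma sum_divisors_mul p m : prime p -> (0 < m)%N -> ~~ (p %| m)%N ->
  (\sum_(d <- divisors (p * m)) d = p.+1 * \sum_(d <- divisors m) d)%N.
Proof.
move=> p_pr m_gt0 ndpm; have p_gt0 := prime_gt0 p_pr.
transitivity (\sum_(d <- divisors m ++ [seq p * d | d <- divisors m]) d)%N.
  apply: perm_big; apply: uniq_perm; first exact: divisors_uniq.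
    rewrite cat_uniq divisors_uniq map_inj_uniq ?divisors_uniq ?andbT.
      apply/hasPn => _ /mapP[d _ ->]; rewrite -dvdn_divisors //.
      by apply: contra ndpm; apply: dvdn_trans; rewrite dvdn_mulr.
    by move=> a b /eqP; rewrite eqn_pmul2l // => /eqP.
  move=> d; rewrite mem_cat -!dvdn_divisors ?muln_gt0 ?p_gt0 //.
  apply/idP/orP => [d_pm|[d_m|/mapP[e + ->]]].
  - have [/dvdnP[e de]|nd] := boolP (p %| d)%N.
      right; apply/mapP; exists e; last by rewrite mulnC.
      by rewrite -dvdn_divisors // -(@dvdn_pmul2l p) // mulnC -de.
    by left; rewrite -(@Gauss_dvdr _ p) // coprime_sym prime_coprime.
  - by rewrite dvdn_mull.
  by rewrite -dvdn_divisors // => e_m; rewrite dvdn_pmul2l.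
by rewrite big_cat big_map -big_distrr mulSn.
Qed.

(** Halving reduces to odd m, where the divisor sum has the factor p + 1; the class of p modulo 10
    makes p odd and p + 1 a multiple of 5. *)
Lemma theta4_eq0_mod5 p m : prime p -> p = 9 %[mod 10] -> (0 < m)%N ->
  ~~ (p %| m)%N -> (theta R ^+ 4) (p * m)%N = 0.
Proof.
move=> p_pr p9; have two_neq0 : 2%:R != 0 :> R.
  (* As 1 = 5 - 2 * 2, the equation 2 = 0 would give 1 = 0. *)
  apply/eqP => two0; have := oner_neq0 R; rewrite (_ : 1 = 5%:R - 2%:R * 2%:R).
    by rewrite five0 two0 mul0r subr0 eqxx.
  by ring.
elim/ltn_ind: m => m IH m_gt0 ndpm.
have [m_odd|m_even] := boolP (odd m).
  rewrite theta4_odd ?oddM ?m_odd ?andbT //; last by lia.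
  rewrite sum_divisors_mul // natrM (_ : p.+1%:R = 0) ?mul0r ?mulr0 //.
  have /dvdnP[q ->] : (5 %| p.+1)%N by lia.
  by rewrite natrM five0 mulr0.
have def_m : m = (2 * (m %/ 2))%N by lia.
rewrite def_m mulnCA theta4_double // IH ?mulr0 //; try lia.
by apply: contra ndpm => d; rewrite def_m dvdn_mull.
Qed.

End ModFive.

Theorem theorem3 (p n i : nat) (p_prime : prime p) (p_mod10 : p = 9 %[mod 10])
    (i_range : 1 <= i <= p - 1) :
  Abar 5 (p * (p * n + i)) = 0 %[mod 5].
Proof.
apply/eqP; rewrite mod0n -/(5 %| _).
rewrite (dvdn_pcharf (@pchar_Fp 5 _)) //.
have five0 : (5%:R = 0 :> 'F_5)%R by apply/val_inj.
rewrite (@Abar5_theta 'F_5 five0) thetaN4 (theta4_eq0_mod5 five0) //.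
- by rewrite mulr0.
- by lia.
(* Since 0 < i < p, the prime p does not divide p n + i. *)
by rewrite dvdn_addr ?dvdn_mulr // gtnNdvd //; lia.
Qed.
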